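(* Consider the online vector scheduling problem on identical machines with the makespan objective (VSMAX-I), as defined in the context. Then: (i) There is a lower bound of $\Omega\left(\frac{\log d}{\log \log d}\right)$ on the competitive ratio of any online algorithm for VSMAX-I; that is, there is no online algorithm whose competitive ratio is $o\left(\frac{\log d}{\log\log d}\right)$ as a function of the number of dimensions $d$. (ii) There is an online algorithm for VSMAX-I whose competitive ratio is $O\left(\frac{\log d}{\log \log d}\right)$.
   Context: Online vector scheduling on identical machines (VSMAX-I): there is a fixed set $M$ of $m$ machines and an integer $d\ge 1$ (the number of dimensions). A set $J$ of $n$ jobs arrives online one at a time; when job $j$ arrives, its $d$-dimensional nonnegative load vector $p_j=\langle p_j(k): k\in[d]\rangle$ is revealed (the same on every machine), and the algorithm must immediately and irrevocably assign $j$ to a machine. An assignment $f:J\to M$ yields loads $\Lambda_i(k)=\sum_{j: f(j)=i} p_j(k)$ for each machine $i$ and dimension $k$; $\Lambda(k)$ denotes the $m$-dimensional vector $(\Lambda_i(k))_{i\in M}$. The makespan in dimension $k$ is $\|\Lambda(k)\|_\infty=\max_{i\in M}\Lambda_i(k)$. Loads are scaled so that the optimal offline assignment has makespan at most $1$ in every dimension (i.e., there exists an assignment with $\|\Lambda(k)\|_\infty\le 1$ for all $k$). An online algorithm is $\alpha$-competitive if on every such instance its assignment satisfies $\|\Lambda(k)\|_\infty\le\alpha$ for every dimension $k$. *)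

(* Defs.v *)
From mathcomp Require Import all_boot all_order all_algebra.
From mathcomp Require Import all_classical all_reals all_analysis.
Import Order.TTheory GRing.Theory Num.Theory.
Import numFieldNormedType.Exports.

Set Implicit Arguments.
Unset Strict Implicit.
Unset Printing Implicit Defensive.

Local Open Scope ring_scope.

(* A job is its load vector in R^d. The machines are 'I_m.+1, so that there is
   always at least one of them. *)

Definition load (R : realType) (m d n : nat) (p : n.-tuple 'rV[R]_d)
    (f : 'I_n -> 'I_m.+1) (i : 'I_m.+1) (k : 'I_d) : R :=
  \sum_(j < n | f j == i) tnth p j ord0 k.

(* Loads are nonnegative, hence the default value 0 is harmless. *)
Definition makespan (R : realType) (m d n : nat) (p : n.-tuple 'rV[R]_d)
    (f : 'I_n -> 'I_m.+1) (k : 'I_d) : R :=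
  \big[Num.max/0]_(i < m.+1) load p f i k.

(* The instances, scaled so that the offline optimum is at most 1. *)
Definition instance (R : realType) (m d n : nat) (p : n.-tuple 'rV[R]_d) : Prop :=
  (forall j k, 0 <= tnth p j ord0 k) /\
  exists f : 'I_n -> 'I_m.+1, forall k, makespan p f k <= 1.

(* A (deterministic) online algorithm chooses a machine given the number of
   machines, the dimension, the jobs that have already arrived (in order of
   arrival) and the current job. Its own earlier decisions are determined by
   the earlier jobs, and the number of jobs to come is not known to it. *)
Definition online_algorithm (R : realType) : Type :=
  forall m d : nat, seq 'rV[R]_d -> 'rV[R]_d -> 'I_m.+1.

Definition run (R : realType) (A : online_algorithm R) (m d n : nat)
    (p : n.-tuple 'rV[R]_d) : 'I_n -> 'I_m.+1 :=
  fun j => A m d (take j p) (tnth p j).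

Definition competitive (R : realType) (A : online_algorithm R) (d : nat)
    (alpha : R) : Prop :=
  forall (m n : nat) (p : n.-tuple 'rV[R]_d), instance m p ->
    forall k : 'I_d, makespan p (run A m p) k <= alpha.

Definition log_ratio (R : realType) (d : nat) : R := ln d%:R / ln (ln d%:R).

(* Main.v *)
Require Import Defs.
From mathcomp Require Import all_boot all_order all_algebra.
From mathcomp Require Import all_classical all_reals all_analysis.
From mathcomp Require Import ring lra zify.
Import Order.TTheory GRing.Theory Num.Theory.
Import numFieldNormedType.Exports.

Local Open Scope ring_scope.

(** Upper bound: each job is first assigned virtually so as not to increase the
    potential [sum_(i, k) exp (b * L_i(k) - (e^b - 1) / M * sum_i' L_i'(k))], which a
    uniformly random machine does not increase on average.  As the volume in each
    dimension is at most [M], this bounds [sum_(i, k) exp (b * L_i(k))], hence the volume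
    of the machines loaded above a threshold [T]: for [b = ln ln d] and [T = 6 ln d / ln ln d],
    the jobs that overflow [T] have total size at most [M] when measured by their largest
    coordinate, and list scheduling spreads them with load at most [2].

    Lower bound: machines are bins, jobs are vertices of a graph properly coloured with
    [M = 4 L^2] colours (the offline assignment), and a dimension is a potential clique of
    [L] vertices, so that a bin containing a clique has load [L].  A new vertex comes with a
    palette of two colours contained in the colour set of no bin, and is adjacent to the
    earlier vertices whose colour is outside the palette.  Once it is in a bin it receives a
    colour new to that bin; hence it is not adjacent to at most one earlier vertex of its
    bin, and every bin is the union of two cliques.  Some bin gets more than [2 (L - 1)]
    vertices within [8 L^3] steps, so [d = (8 L^3)^L] dimensions force load [L]. *)

(** * Loads along a list of arrivals, and bounds implied by the offline optimum *)

Section SequenceLoad.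
Context {R : realType} {d M : nat}.
Variable a : seq 'rV[R]_d -> 'rV[R]_d -> 'I_M.

Definition seq_load (s : seq 'rV[R]_d) (i : 'I_M) (k : 'I_d) : R :=
  \sum_(0 <= j < size s | a (take j s) (nth 0 s j) == i) nth 0 s j ord0 k.

Lemma seq_load_rcons s x i k :
  seq_load (rcons s x) i k = seq_load s i k + (if a s x == i then x ord0 k else 0).
Proof.
rewrite /seq_load size_rcons big_mkcond big_nat_recr //=.
rewrite nth_rcons ltnn eqxx -cats1 take_size_cat //; congr (_ + _).
rewrite [RHS]big_mkcond; apply: eq_big_nat => j /andP[_ jlt].
by rewrite cats1 nth_rcons jlt -cats1 takel_cat // ltnW.
Qed.

End SequenceLoad.

Section Instances.
Context {R : realType} {m d n : nat}.
Implicit Types (p : n.-tuple 'rV[R]_d) (f : 'I_n -> 'I_m.+1).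

Lemma load_run (A : online_algorithm R) p i k :
  load p (run A m p) i k = seq_load (A m d) p i k.
Proof.
rewrite /load /seq_load big_mkord size_tuple; apply: eq_big => [j|j _].
  by rewrite /run (tnth_nth 0).
by rewrite (tnth_nth 0).
Qed.

Lemma load_le_makespan p f i k : load p f i k <= makespan p f k.
Proof. exact: (le_bigmax 0 (fun i => load p f i k)). Qed.

Lemma instance_le1 p j k : instance m p -> tnth p j ord0 k <= 1.
Proof.
move=> [p0 [f /(_ k) fk]]; apply: le_trans fk; apply: le_trans (load_le_makespan p f (f j) k).
rewrite /load (bigD1 j) //= lerDl; apply: sumr_ge0 => j' _; exact: p0.
Qed.

Lemma instance_volume p k : instance m p -> \sum_(x <- p) x ord0 k <= m.+1%:R.
Proof.
move=> [p0 [f /(_ k) fk]].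
have -> : \sum_(x <- p) x ord0 k = \sum_(i < m.+1) load p f i k.
  rewrite big_tuple /load.
  rewrite (exchange_big_dep xpredT) //=; apply: eq_bigr => j _.
  by rewrite (big_pred1 (f j)) //= => i; rewrite eq_sym.
apply: (@le_trans _ _ (\sum_(i < m.+1) 1)); last by rewrite sumr_const card_ord.
by apply: ler_sum => i _; apply: le_trans fk; exact: load_le_makespan.
Qed.

End Instances.

(** Convexity: [b * x] is the mean of [b] and [0] with weights [x] and [1 - x]. *)
Lemma expR_chord {R : realType} (b x : R) :
  0 <= x <= 1 -> expR (b * x) - 1 <= x * (expR b - 1).
Proof.
move=> /andP[x0 x1]; have := convex_expR (Itv01 x0 x1) b 0.
by rewrite !convRE /= mulr0 addr0 expR0 mulr1 [b * x]mulrC /unstable.onem; lra.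
Qed.

Lemma arg_min_mean {R : realType} {m : nat} (F : 'I_m.+1 -> R) :
  F [arg min_(i < ord0) F i]%O <= (\sum_i F i) / m.+1%:R.
Proof.
case: arg_minP => // i _ Fi; rewrite ler_pdivlMr ?ltr0n //.
apply: (@le_trans _ _ (\sum_(j < m.+1) F i)); last by apply: ler_sum => j _; exact: Fi.
by rewrite sumr_const card_ord mulr_natr.
Qed.

(** * The two-phase algorithm and its potential *)

Section Algorithm.
Context {R : realType} (m d : nat).
Variables b T : R.
Implicit Types (L : 'I_m.+1 -> 'I_d -> R) (W : 'I_m.+1 -> R) (x : 'rV[R]_d).

Definition add_job L (i : 'I_m.+1) x : 'I_m.+1 -> 'I_d -> R :=
  fun i' k => L i' k + (if i' == i then x ord0 k else 0).

Definition peak x : R := \big[Num.max/0]_k x ord0 k.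

Let c : R := (expR b - 1) / m.+1%:R.

Definition weight L i k : R := expR (b * L i k - c * \sum_i' L i' k).

Definition potential L : R := \sum_k \sum_i weight L i k.

Lemma sum_add_job L i x k :
  \sum_i' add_job L i x i' k = \sum_i' L i' k + x ord0 k.
Proof.
rewrite /add_job big_split /=; congr (_ + _).
by rewrite -big_mkcond big_pred1_eq.
Qed.

Lemma sum_weight_add_job L i x k :
  \sum_i' weight (add_job L i x) i' k =
  expR (- (c * x ord0 k)) *
    (\sum_i' weight L i' k + (expR (b * x ord0 k) - 1) * weight L i k).
Proof.
rewrite (bigD1 i) //= [in RHS](bigD1 i) //=.
have -> : weight (add_job L i x) i k =
    expR (- (c * x ord0 k)) * expR (b * x ord0 k) * weight L i k.
  rewrite /weight -!expRD sum_add_job /add_job eqxx; congr expR; ring.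
have -> : \sum_(i' < m.+1 | i' != i) weight (add_job L i x) i' k =
    expR (- (c * x ord0 k)) * \sum_(i' < m.+1 | i' != i) weight L i' k.
  rewrite mulr_sumr; apply: eq_bigr => i' /negPf ne.
  by rewrite /weight -!expRD sum_add_job /add_job ne; congr expR; ring.
ring.
Qed.

Definition primary L x : 'I_m.+1 :=
  [arg min_(i < ord0) potential (add_job L i x)]%O.

(** The minimum is at most the mean over machines, which in dimension [k] multiplies the sum of
    weights by at most [expR (- (c * x_k)) * (1 + c * x_k) <= 1], by the chord bound and the choice
    of [c]. *)
Lemma potential_primary L x : 0 <= b -> (forall k, 0 <= x ord0 k <= 1) ->
  potential (add_job L (primary L x) x) <= potential L.
Proof.
move=> b0 x01.
apply: le_trans (arg_min_mean (fun i => potential (add_job L i x))) _.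
rewrite ler_pdivrMr ?ltr0n // /potential exchange_big /= mulr_suml.
apply: ler_sum => k _.
under eq_bigr do rewrite sum_weight_add_job.
rewrite -mulr_sumr big_split /= sumr_const card_ord -mulr_sumr.
set S := \sum_i _; rewrite -(mulr_natr S).
have S0 : 0 <= S by apply: sumr_ge0 => i _; exact: expR_ge0.
have M0 : 0 < m.+1%:R :> R by rewrite ltr0n.
have xk := expR_chord b _ (x01 k).
have cx : x ord0 k * (expR b - 1) = m.+1%:R * (c * x ord0 k).
  by rewrite /c; field; rewrite gt_eqF.
have e1 := expR_ge1Dx (c * x ord0 k).
have e2 : expR (- (c * x ord0 k)) * expR (c * x ord0 k) = 1.
  by rewrite -expRD addNr expR0.
have -> : S * m.+1%:R + (expR (b * x ord0 k) - 1) * S =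
  (m.+1%:R + (expR (b * x ord0 k) - 1)) * S by ring.
rewrite [leRHS]mulrC mulrA; apply: ler_wpM2r => //.
apply: (@le_trans _ _ (expR (- (c * x ord0 k)) * (expR (c * x ord0 k) * m.+1%:R)));
  last by rewrite mulrA e2 mul1r.
rewrite ler_pM2l ?expR_gt0 //.
rewrite cx in xk; nra.
Qed.

Definition overflows L x : bool :=
  [exists k, T < add_job L (primary L x) x (primary L x) k].

Definition secondary W : 'I_m.+1 := [arg min_(i < ord0) W i]%O.

(** The first component counts every job on its primary machine, even an overflowing one that is
    really placed elsewhere; the second counts only overflowing jobs, each by its peak. *)
Definition state : Type := ('I_m.+1 -> 'I_d -> R) * ('I_m.+1 -> R).

Definition step (st : state) x : state :=
  (add_job st.1 (primary st.1 x) x,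
   if overflows st.1 x
   then fun i => st.2 i + (if i == secondary st.2 then peak x else 0)
   else st.2).

Definition run_state (s : seq 'rV[R]_d) : state :=
  foldl step (fun _ _ => 0, fun _ => 0) s.

Definition two_phase (s : seq 'rV[R]_d) x : 'I_m.+1 :=
  let st := run_state s in
  if overflows st.1 x then secondary st.2 else primary st.1 x.

Lemma run_state_rcons s x : run_state (rcons s x) = step (run_state s) x.
Proof. exact: foldl_rcons. Qed.

Definition unit_job x : Prop := forall k, 0 <= x ord0 k <= 1.

Lemma peak_ge0 x : 0 <= peak x.
Proof. exact: bigmax_ge_id. Qed.

Lemma le_peak x k : x ord0 k <= peak x.
Proof. exact: (le_bigmax 0 (fun k => x ord0 k)). Qed.

Lemma peak_le1 x : unit_job x -> peak x <= 1.
Proof. by move=> x01; apply: bigmax_le => // k _; case/andP: (x01 k). Qed.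

Lemma peak_le_sum x : unit_job x -> peak x <= \sum_k x ord0 k.
Proof.
move=> x01; have x0 k : 0 <= x ord0 k by case/andP: (x01 k).
apply: bigmax_le => [|k _]; first exact: sumr_ge0.
by rewrite (bigD1 k) //= lerDl sumr_ge0.
Qed.

Lemma unit_jobs_rcons {s x} : {in rcons s x, forall y, unit_job y} ->
  {in s, forall y, unit_job y} /\ unit_job x.
Proof.
move=> h; split=> [y ys|]; last by apply: h; rewrite mem_rcons mem_head.
by apply: h; rewrite mem_rcons in_cons ys orbT.
Qed.

Lemma le_add_job L i x i' k : unit_job x -> L i' k <= add_job L i x i' k.
Proof.
by move=> /(_ k)/andP[x0 _]; rewrite /add_job lerDl; case: ifP.
Qed.

Lemma primary_load_ge0 s i k : {in s, forall x, unit_job x} ->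
  0 <= (run_state s).1 i k.
Proof.
elim/last_ind: s => [|s x IH] // /unit_jobs_rcons[/IH s0 x01].
by rewrite run_state_rcons (le_trans s0) //= le_add_job.
Qed.

Lemma sum_primary_load s k :
  \sum_i (run_state s).1 i k = \sum_(x <- s) x ord0 k.
Proof.
elim/last_ind: s => [|s x IH]; first by rewrite big_nil big1.
by rewrite run_state_rcons /= sum_add_job IH -cats1 big_cat big_seq1.
Qed.

Lemma potential_run_state s : 0 <= b -> {in s, forall x, unit_job x} ->
  potential (run_state s).1 <= m.+1%:R * d%:R.
Proof.
move=> b0; elim/last_ind: s => [|s x IH] => [_|/unit_jobs_rcons[/IH s0 x01]].
  rewrite /potential /weight /=; under eq_bigr do under eq_bigr do
    rewrite big1 // !mulr0 subr0 expR0.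
  by under eq_bigr do rewrite sumr_const card_ord; rewrite sumr_const card_ord mulr_natr.
by rewrite run_state_rcons /=; apply: le_trans (potential_primary _ _ b0 x01) s0.
Qed.

Lemma sum_secondary_load_step s x :
  \sum_i (run_state (rcons s x)).2 i =
  \sum_i (run_state s).2 i + (if overflows (run_state s).1 x then peak x else 0).
Proof.
rewrite run_state_rcons /=; case: ifP => _; last by rewrite addr0.
by rewrite big_split /= -big_mkcond big_pred1_eq.
Qed.

(* List scheduling: a job goes to a machine whose secondary load is at most the mean. *)
Lemma secondary_load_le s i : {in s, forall x, unit_job x} ->
  (run_state s).2 i <= (\sum_i' (run_state s).2 i') / m.+1%:R + 1.
Proof.
elim/last_ind: s i => [|s x IH] i => [_|/unit_jobs_rcons[/(IH i) s0 x01]].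
  by rewrite /= big1 // mul0r add0r ler01.
rewrite sum_secondary_load_step run_state_rcons /=; case: ifP => _; last by rewrite addr0.
have px := divr_ge0 (peak_ge0 x) (ler0n R m.+1); have px1 := peak_le1 x x01.
rewrite mulrDl; case: eqP => [->|_]; last by rewrite addr0 -addrA [X in _ + X]addrC addrA ler_wpDr.
have := arg_min_mean (run_state s).2; rewrite -/(secondary _) => h; apply: le_trans (lerD h px1) _.
by rewrite -addrA lerD2l lerDr.
Qed.

Definition overloaded L i : bool := [exists k, T < L i k].

(** An overflowing job leaves its primary machine overloaded for good, and its peak is at most the
    sum of its coordinates, so the virtual volume of that machine pays for it. *)
Lemma sum_secondary_load_le s : {in s, forall x, unit_job x} ->
  \sum_i (run_state s).2 i <=
  \sum_(i | overloaded (run_state s).1 i) \sum_k (run_state s).1 i k.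
Proof.
elim/last_ind: s => [|s x IH] => [_|sx].
  by rewrite /= big1 //; apply: sumr_ge0 => i _; apply: sumr_ge0.
have [/[dup] /IH s0 sunit x01] := unit_jobs_rcons sx.
rewrite sum_secondary_load_step run_state_rcons /=.
set L := (run_state s).1 in s0 *; set i0 := primary L x.
have L0 i k : 0 <= L i k by exact: primary_load_ge0.
have x0 k : 0 <= x ord0 k by case/andP: (x01 k).
have over_mono i : overloaded L i -> overloaded (add_job L i0 x) i.
  by move=> /existsP[k /lt_le_trans Lk]; apply/existsP; exists k; rewrite Lk ?le_add_job.
apply: le_trans (lerD s0 (lexx _)) _.
rewrite big_mkcond [leRHS]big_mkcond /=.
rewrite (bigD1 i0) //= [leRHS](bigD1 i0) //= addrAC lerD //.
  have sum0 : 0 <= \sum_k L i0 k by exact: sumr_ge0.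
  have sumx0 : 0 <= \sum_k x ord0 k by exact: sumr_ge0.
  have add_i0 : \sum_k add_job L i0 x i0 k = \sum_k L i0 k + \sum_k x ord0 k.
    by rewrite -big_split /=; apply: eq_bigr => k _; rewrite /add_job eqxx.
  have px := peak_le_sum x x01.
  have [ov|nov] := boolP (overflows L x).
    have -> : overloaded (add_job L i0 x) i0 by exact: ov.
    rewrite add_i0; case: ifP => _; lra.
  case: ifP => [/over_mono ->|_]; first by rewrite add_i0; lra.
  rewrite addr0; case: ifP => // _; rewrite add_i0; lra.
apply: ler_sum => i _; case: ifP => [/over_mono ->|_].
  by apply: ler_sum => k _; exact: le_add_job.
by case: ifP => // _; apply: sumr_ge0 => k _; apply: le_trans (le_add_job L i0 x i k x01).
Qed.

(** A job kept on its primary machine raises real and virtual load equally and leaves the latter at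
    most [T]. The minimum makes this inductive: the bound [T] alone would leave no room for the new
    job. *)
Lemma two_phase_load_le s i k : 0 <= T -> {in s, forall x, unit_job x} ->
  seq_load two_phase s i k <=
    Num.min T ((run_state s).1 i k) + (run_state s).2 i.
Proof.
move=> T0; elim/last_ind: s => [|s x IH] => [_|/unit_jobs_rcons[/IH s0 x01]].
  by rewrite /seq_load big_geq //= addr0 le_min T0 lexx.
rewrite seq_load_rcons run_state_rcons /= /two_phase /=.
set L := (run_state s).1 in s0 *; set W := (run_state s).2 in s0 *.
set l := seq_load _ s i k in s0 *.
have Li : L i k <= add_job L (primary L x) x i k by exact: le_add_job.
have mono : Num.min T (L i k) <= Num.min T (add_job L (primary L x) x i k).
  by rewrite le_min !ge_min lexx Li orbT.
have [ov|nov] := boolP (overflows L x).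
  rewrite [secondary W == i]eq_sym; case: eqP => _; last by rewrite !addr0; lra.
  have xk := le_peak x k; lra.
case: eqP => [ei|_]; last by rewrite addr0; lra.
have le_T : add_job L (primary L x) x i k <= T.
  by move: nov; rewrite negb_exists => /forallP /(_ k); rewrite -leNgt ei.
rewrite (min_r le_T); have mL : Num.min T (L i k) <= L i k by rewrite ge_min lexx orbT.
rewrite /add_job -ei eqxx ei; lra.
Qed.

(** For [y > T], [y <= expR y <= expR (b * y - b * T / 2)] because [b >= 2]; coordinates not above
    [T] are dominated by one that is, whence the factor [d]. *)
Lemma overloaded_load_le L i : 2 <= b -> 0 <= T -> (forall k, 0 <= L i k) ->
  overloaded L i ->
  \sum_k L i k <= d%:R * (expR (- (b * T / 2)) * \sum_k expR (b * L i k)).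
Proof.
move=> b2 T0 L0 /existsP[k0 Lk0].
have sum_ge k : expR (b * L i k) <= \sum_k expR (b * L i k).
  by rewrite (bigD1 k) //= lerDl; apply: sumr_ge0 => k' _; exact: expR_ge0.
have big_load k : T < L i k -> L i k <= expR (- (b * T / 2)) * \sum_k expR (b * L i k).
  move=> Tk; apply: (@le_trans _ _ (expR (- (b * T / 2)) * expR (b * L i k))); last first.
    by rewrite ler_pM2l ?expR_gt0.
  rewrite -expRD; apply: (@le_trans _ _ (expR (L i k))).
    have h := expR_ge1Dx (L i k); lra.
  have b2_ge0 : 0 <= b - 2 by lra.
  have LT : 0 <= L i k - T / 2 by lra.
  by rewrite ler_expR; have h := mulr_ge0 b2_ge0 LT; lra.
rewrite mulr_natl -[X in _ *+ X]card_ord -sumr_const; apply: ler_sum => k _.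
have [/big_load //|Lk] := ltP T (L i k).
by apply: le_trans (big_load k0 Lk0); apply: le_trans Lk (ltW Lk0).
Qed.

(** The volume bound keeps the correction [c * \sum_i L i k] at most [expR b - 1]. *)
Lemma sum_expR_load_le L : 0 <= b -> (forall k, \sum_i L i k <= m.+1%:R) ->
  \sum_i \sum_k expR (b * L i k) <= expR (expR b - 1) * potential L.
Proof.
move=> b0 vol; rewrite exchange_big /potential mulr_sumr; apply: ler_sum => k _.
rewrite mulr_sumr; apply: ler_sum => i _; rewrite /weight -expRD ler_expR.
have b1 : 0 <= expR b - 1 by have h := expR_ge1Dx b; lra.
have cV : c * \sum_i L i k <= expR b - 1.
  by rewrite /c mulrAC ler_pdivrMr ?ltr0n // ler_wpM2l.
lra.
Qed.

(** In the condition on [T], one [d] stems from the initial potential, one from the coordinates of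
    an overloaded machine, and [expR (expR b)] from removing the volume correction. It makes the
    secondary loads sum to at most the number of machines. *)
Lemma two_phase_competitive s i k : 2 <= b -> 0 <= T ->
  d%:R ^+ 2 * expR (expR b) <= expR (b * T / 2) ->
  {in s, forall x, unit_job x} ->
  (forall k, \sum_(x <- s) x ord0 k <= m.+1%:R) ->
  seq_load two_phase s i k <= T + 2.
Proof.
move=> b2 T0 bT s01 vol.
have b0 : 0 <= b by lra.
set L := (run_state s).1; set W := (run_state s).2.
have L0 i' k' : 0 <= L i' k' by exact: primary_load_ge0.
have pot := potential_run_state s b0 s01.
have volL k' : \sum_i' L i' k' <= m.+1%:R by rewrite sum_primary_load.
have sumE := sum_expR_load_le L b0 volL.
have sumW : \sum_i' W i' <= m.+1%:R.
  apply: le_trans (sum_secondary_load_le s s01) _.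
  apply: (@le_trans _ _ (\sum_i' d%:R * (expR (- (b * T / 2)) * \sum_k expR (b * L i' k)))).
    rewrite big_mkcond /=; apply: ler_sum => i' _; case: ifP => ov.
      by apply: overloaded_load_le.
    by rewrite !mulr_ge0 ?expR_ge0 ?sumr_ge0 // => k' _; exact: expR_ge0.
  rewrite -mulr_sumr -mulr_sumr.
  apply: (@le_trans _ _ (d%:R * (expR (- (b * T / 2)) *
    (expR (expR b) * (m.+1%:R * d%:R))))).
    rewrite !ler_wpM2l ?expR_ge0 //; apply: le_trans sumE _.
    apply: ler_pM pot; rewrite ?expR_ge0 ?ler_expR //; last by lra.
    by apply: sumr_ge0 => k' _; apply: sumr_ge0 => i' _; exact: expR_ge0.
  have -> : d%:R * (expR (- (b * T / 2)) * (expR (expR b) * (m.+1%:R * d%:R))) =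
     m.+1%:R * (expR (- (b * T / 2)) * (d%:R ^+ 2 * expR (expR b))) by ring.
  rewrite -[leRHS]mulr1 ler_wpM2l //.
  by rewrite expRN mulrC ler_pdivrMr ?expR_gt0 // mul1r.
have W2 : W i <= 2.
  apply: le_trans (secondary_load_le s i s01) _.
  by rewrite -[leRHS]/(1 + 1) lerD2r ler_pdivrMr ?ltr0n // mul1r.
apply: le_trans (two_phase_load_le s i k T0 s01) _.
by apply: lerD W2; rewrite ge_min lexx.
Qed.

End Algorithm.

(* [base] is ln ln d for large d; the clipping at 2 only serves small d. *)
Definition base (R : realType) (d : nat) : R := Num.max 2 (ln (ln d%:R)).

(** Solves [b * T / 2 = 2 * ln d + expR b], so that for [d >= 1] the condition in
    [two_phase_competitive] is an equality. *)
Definition threshold (R : realType) (d : nat) : R :=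
  2 * (2 * ln d%:R + expR (base R d)) / base R d.

Lemma threshold_ge0 (R : realType) (d : nat) : 0 <= threshold R d.
Proof.
have b0 : 0 <= base R d by rewrite /base le_max ler0n.
have ln0 : 0 <= ln d%:R :> R.
  by case: d {b0} => [|d]; [rewrite ln0|rewrite ln_ge0 ?ler1n].
by rewrite /threshold divr_ge0 // mulr_ge0 // addr_ge0 ?mulr_ge0 ?expR_ge0.
Qed.

Definition vector_scheduler (R : realType) : online_algorithm R :=
  fun m d => two_phase m d (base R d) (threshold R d).

Lemma vector_scheduler_competitive (R : realType) (d : nat) : (1 <= d)%N ->
  competitive (vector_scheduler R) d (threshold R d + 2).
Proof.
move=> d1 m n p inst k.
have b2 : 2 <= base R d by rewrite /base le_max lexx.
have d1R : 1 <= d%:R :> R by rewrite ler1n.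
have T0 := threshold_ge0 R d.
apply: bigmax_le => [|i _]; first by lra.
rewrite load_run; apply: two_phase_competitive => //.
- have -> : base R d * threshold R d / 2 = ln d%:R + ln d%:R + expR (base R d).
    rewrite /threshold; field; rewrite gt_eqF //; lra.
  by rewrite !expRD lnK ?posrE -?expr2 //; lra.
- move=> x /tnthP[j ->] k'; rewrite (instance_le1 p j k' inst) andbT; exact: (proj1 inst).
- by move=> k'; exact: instance_volume inst.
Qed.

(** * Lower bound: counting, and the colouring game of the adversary *)

Lemma sum_count_fibers {M : nat} (f : nat -> 'I_M) (s : seq nat) :
  (\sum_b count (fun v => f v == b) s)%N = size s.
Proof.
elim: s => [|v s IH] /=; first by rewrite big1.
by rewrite big_split /= IH -[X in (X + _)%N]big_mkcond (big_pred1 (f v)) // => b; rewrite eq_sym.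
Qed.

Lemma sum_indicator {R : realType} (s : seq nat) (P F : pred nat) :
  \sum_(j <- s | P j) (F j)%:R = (count (fun j => P j && F j) s)%:R :> R.
Proof.
by rewrite -natr_sum -sum1_count big_mkcondr /=.
Qed.

(** Each of the [M] bins covers at most [c ^ 2] ordered pairs of colours, fewer than [M ^ 2] in all.
    The two colours may coincide. *)
Lemma palette_exists {M c : nat} (C : 'I_M -> {set 'I_M}) :
  (forall b, #|C b| <= c)%N -> (c ^ 2 < M)%N ->
  exists x y, forall b, ~~ ((x \in C b) && (y \in C b)).
Proof.
move=> cardC ltM.
have [/existsP[x /existsP[y /forallP xy]]|none] :=
  boolP [exists x, [exists y, [forall b, ~~ ((x \in C b) && (y \in C b))]]].
  by exists x, y.
have cover : [set: 'I_M * 'I_M] \subset \bigcup_b finset.setX (C b) (C b).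
  apply/fintype.subsetP => -[x y] _.
  move: none; rewrite negb_exists => /forallP/(_ x).
  rewrite negb_exists => /forallP/(_ y); rewrite negb_forall => /existsP[b].
  by rewrite negbK => xy; apply/finset.bigcupP; exists b => //; rewrite finset.in_setX.
have := subset_leq_card cover; rewrite cardsT card_prod card_ord.
have le_sum : (#|\bigcup_b finset.setX (C b) (C b)| <= \sum_(b < M) c ^ 2)%N.
  apply: (@leq_trans (\sum_b #|finset.setX (C b) (C b)|)%N); last first.
    by apply: leq_sum => b _; rewrite cardsX -mulnn leq_mul.
  elim/big_ind2: _ => // [|A x B y ? ?]; first by rewrite cards0.
  by rewrite cardsU (leq_trans (leq_subr _ _)) ?leq_add.
move=> /leq_trans/(_ le_sum); rewrite sum_nat_const card_ord.
by rewrite leqNgt ltn_mul2l ltM (leq_ltn_trans (leq0n _) ltM).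
Qed.

Section Adversary.
Context {R : realType} {d m : nat}.
Variables (L N : nat) (a : seq 'rV[R]_d -> 'rV[R]_d -> 'I_m.+1).

(* Each dimension bets on one candidate clique of L vertices among the first N. *)
Definition guess (k : nat) : seq nat :=
  nth [::] [seq [seq val i | i <- tval t] | t <- enum {: L.-tuple 'I_N}] k.

Lemma guess_surj (q : seq nat) : (N ^ L <= d)%N ->
  size q = L -> {in q, forall v, (v < N)%N} -> exists k : 'I_d, guess k = q.
Proof.
move=> Nd sq qN.
have [q' q'E] : exists q' : seq 'I_N, [seq val i | i <- q'] = q.
  elim: q qN {sq} => [|v q IH] qN; first by exists [::].
  have [|q' <-] := IH; first by move=> u uq; apply: qN; rewrite in_cons uq orbT.
  by exists (Ordinal (qN v (mem_head _ _)) :: q').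
have sq' : size q' == L by rewrite -sq -q'E size_map.
have mem_t : Tuple sq' \in enum {: L.-tuple 'I_N} by rewrite mem_enum.
have idx : (index (Tuple sq') (enum {: L.-tuple 'I_N}) < size (enum {: L.-tuple 'I_N}))%N.
  by rewrite index_mem.
have idx_d : (index (Tuple sq') (enum {: L.-tuple 'I_N}) < d)%N.
  apply: leq_trans idx (leq_trans _ Nd).
  by rewrite -cardE card_tuple card_ord.
exists (Ordinal idx_d); rewrite /guess /= (nth_map (Tuple sq')) //.
by rewrite nth_index.
Qed.

(** Two vertices hit in the same dimension are adjacent. Only earlier vertices are consulted, so the
    job of [v] can be issued on its arrival. *)
Definition hit (adj : rel nat) (v k : nat) : bool :=
  (v \in guess k) && all (fun u => (u < v)%N ==> adj u v) (guess k).

(* [col] is the offline assignment, [bin] the online one, and [cls] splits each bin into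
   two cliques of the graph [adj], which is only meaningful on pairs [u < v]. *)
Record position (t : nat) (s : seq 'rV[R]_d) (col bin : nat -> 'I_m.+1)
    (cls : nat -> bool) (adj : rel nat) : Prop := Position {
  pos_size : size s = t;
  pos_job : forall v (k : 'I_d), (v < t)%N -> nth 0 s v ord0 k = (hit adj v k)%:R;
  pos_bin : forall v, (v < t)%N -> bin v = a (take v s) (nth 0 s v);
  pos_proper : forall u v, (u < v < t)%N -> adj u v -> col u <> col v;
  pos_fresh : forall u v, (u < v < t)%N -> bin u = bin v -> col u <> col v;
  pos_clique : forall u v, (u < v < t)%N -> bin u = bin v -> cls u = cls v -> adj u v }.

Section Position.
Context {t : nat} {s : seq 'rV[R]_d} {col bin : nat -> 'I_m.+1}.
Context {cls : nat -> bool} {adj : rel nat}.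
Hypothesis pos : position t s col bin cls adj.

(** With [col] as assignment, properness leaves each machine at most one unit job per dimension. *)
Lemma position_instance : instance m (in_tuple s).
Proof.
have jobE (j : 'I_(size s)) (k : 'I_d) :
    tnth (in_tuple s) j ord0 k = (hit adj j k)%:R.
  by rewrite (tnth_nth 0) /= (pos_job _ _ _ _ _ _ pos) // -(pos_size _ _ _ _ _ _ pos).
split=> [j k|]; first by rewrite jobE.
exists (fun j => col j) => k; apply: bigmax_le => // i _; rewrite /load.
under eq_bigr do rewrite jobE.
have [j0 /andP[cj0 hj0]|none] := pickP [pred j : 'I_(size s) | (col j == i) && hit adj j k].
  rewrite (bigD1 j0) //= hj0 big1 ?addr0 // => j /andP[cj jne].
  case hj: (hit adj j k) => //; exfalso.
  wlog lt : j j0 cj0 hj0 cj jne hj / (j < j0)%N => [th|].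
    have [lt|lt|/val_inj e] := ltngtP (val j) (val j0); last by rewrite e eqxx in jne.
      exact: (th j j0).
    by apply: (th j0 j) => //; rewrite eq_sym.
  case/andP: hj => jg _; case/andP: hj0 => _ /allP/(_ _ jg); rewrite lt /= => adj_jj0.
  have ltt : (j < j0 < t)%N by rewrite lt -(pos_size _ _ _ _ _ _ pos) ltn_ord.
  by apply: (pos_proper _ _ _ _ _ _ pos _ _ ltt adj_jj0); rewrite (eqP cj) (eqP cj0).
rewrite big1 // => j cj; have := none j; rewrite /= cj /=.
by move=> ->.
Qed.

Lemma position_load b (k : 'I_d) :
  seq_load a s b k = (count (fun v => (bin v == b) && hit adj v k) (iota 0 t))%:R.
Proof.
rewrite /seq_load -sum_indicator (pos_size _ _ _ _ _ _ pos) /index_iota subn0.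
rewrite big_seq_cond [RHS]big_seq_cond; apply: eq_big => [v|v].
  rewrite mem_iota add0n /=; case: ltnP => //= vt.
  by rewrite (pos_bin _ _ _ _ _ _ pos).
by rewrite mem_iota add0n /= => /andP[vt _]; rewrite (pos_job _ _ _ _ _ _ pos).
Qed.

(** [L] vertices of one class in one bin form a clique, and the dimension betting on it would show
    load [L]. *)
Lemma class_size_lt b e : (t <= N)%N -> (N ^ L <= d)%N ->
  (forall k : 'I_d, seq_load a s b k < L%:R) ->
  (count (fun v => (bin v == b) && (cls v == e)) (iota 0 t) < L)%N.
Proof.
move=> tN Nd small; rewrite ltnNge; apply/negP => leL.
set P := fun v => _ in leL.
pose q := take L [seq v <- iota 0 t | P v].
have sq : size q = L by rewrite size_takel // size_filter.
have qP v : v \in q -> [/\ (v < t)%N, bin v = b & cls v = e].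
  move=> /mem_take; rewrite mem_filter mem_iota add0n /= => /andP[/andP[/eqP ? /eqP ?] ?].
  by [].
have uq : uniq q by rewrite take_uniq // filter_uniq // iota_uniq.
have [|k kq] := guess_surj q Nd sq.
  by move=> v /qP[vt _ _]; apply: leq_trans tN.
have := small k; rewrite position_load ltr_nat ltnNge -[X in (X <= _)%N]sq.
rewrite -size_filter uniq_leq_size // => v vq; have [vt vb ve] := qP v vq.
rewrite mem_filter mem_iota add0n vt vb eqxx /= andbT /hit kq vq /=.
apply/allP => u uq'; apply/implyP => uv; have [ut ub ue] := qP u uq'.
by apply: (pos_clique _ _ _ _ _ _ pos); rewrite ?uv ?vb ?ve.
Qed.

Lemma bin_size_le b : (t <= N)%N -> (N ^ L <= d)%N ->
  (forall k : 'I_d, seq_load a s b k < L%:R) ->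
  (count (fun v => bin v == b) (iota 0 t) <= L.-1.*2)%N.
Proof.
move=> tN Nd small.
have h1 := class_size_lt b true tN Nd small.
have h2 := class_size_lt b false tN Nd small.
have : (count (fun v => bin v == b) (iota 0 t) <=
    count (fun v => (bin v == b) && (cls v == true)) (iota 0 t) +
    count (fun v => (bin v == b) && (cls v == false)) (iota 0 t))%N.
  elim: (iota 0 t) => //= v l IH; case: (bin v == b); case: (cls v) => /=; lia.
by move=> h; apply: leq_trans h _; lia.
Qed.

(** The palette fixes the job before the bin is known; colour and class are chosen afterwards, so as
    to keep the bin's colours distinct and its two classes cliques. *)
Lemma position_extend (c : nat) :
  (forall b, count (fun v => bin v == b) (iota 0 t) <= c)%N -> (c ^ 2 < m.+1)%N ->
  exists s' col' bin' cls' adj', position t.+1 s' col' bin' cls' adj'.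
Proof.
move=> small ltm.
pose C b := [set col (val v) | v in [set v : 'I_t | bin v == b]].
have cardC b : (#|C b| <= c)%N.
  apply: leq_trans (leq_imset_card _ _) (leq_trans _ (small b)).
  have -> : iota 0 t = index_iota 0 t by rewrite /index_iota subn0.
  rewrite -sum1_card -sum1_count (big_mkord (fun v => bin v == b)).
  by under eq_bigl do rewrite inE.
have [x [y xy]] := palette_exists C cardC ltm.
have memC u b : (u < t)%N -> bin u = b -> col u \in C b.
  by move=> ut ub; apply/imsetP; exists (Ordinal ut); rewrite ?inE ?ub.
pose adj' u v := if v == t then (col u != x) && (col u != y) else adj u v.
pose job : 'rV[R]_d := \row_k (hit adj' t k)%:R.
pose bt := a s job.
(* The palette is not contained in [C bt], so one of its colours is new to the bin. *)
pose xt := if x \in C bt then y else x.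
pose yt := if x \in C bt then x else y.
have xt_fresh : xt \notin C bt.
  by rewrite /xt; have := xy bt; case: (boolP (x \in C bt)).
(* The class opposite to that of the only possible non-neighbour in the bin. *)
pose et := ~~ [exists v : 'I_t, [&& bin v == bt, col v == yt & cls v]].
pose upd (T : Type) (f : nat -> T) (z : T) (v : nat) := if v == t then z else f v.
exists (rcons s job), (upd _ col xt), (upd _ bin bt), (upd _ cls et), adj'.
have st := pos_size _ _ _ _ _ _ pos.
have adjE u v : (u < v < t)%N -> adj' u v = adj u v.
  by move=> /andP[_ vt]; rewrite /adj' ltn_eqF.
have updE T (f : nat -> T) z v : (v < t)%N -> upd T f z v = f v.
  by move=> vt; rewrite /upd ltn_eqF.
have updt T (f : nat -> T) z : upd T f z t = z by rewrite /upd eqxx.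
have ltS u v : (u < v < t.+1)%N -> (u < t)%N /\ (v = t \/ (u < v < t)%N).
  by move=> ?; split; lia.
split.
- by rewrite size_rcons st.
- move=> v k; rewrite ltnS leq_eqVlt nth_rcons st => /orP[/eqP->|vt].
    by rewrite ltnn eqxx mxE.
  rewrite vt (pos_job _ _ _ _ _ _ pos) //; congr (nat_of_bool (_ && _))%:R.
  apply: eq_all => u; case: (ltnP u v) => //= uv; by rewrite adjE ?uv.
- move=> v; rewrite ltnS leq_eqVlt nth_rcons st -cats1 => /orP[/eqP->|vt].
    by rewrite updt ltnn eqxx -st take_size_cat.
  by rewrite updE // vt takel_cat ?st ?(ltnW vt) // (pos_bin _ _ _ _ _ _ pos).
- move=> u v /ltS[ut [->|uv]]; rewrite updE //.
    rewrite updt /adj' eqxx /xt => /andP[/eqP ? /eqP ?]; by case: ifP.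
  by rewrite updE 1?adjE //; [exact: (pos_proper _ _ _ _ _ _ pos)|case/andP: uv].
- move=> u v /ltS[ut [->|uv]]; rewrite !(updE _ _ _ u) //.
    rewrite !updt => ub ux; move: xt_fresh; by rewrite -ux memC.
  rewrite !updE; try by case/andP: uv.
  exact: (pos_fresh _ _ _ _ _ _ pos).
- move=> u v /ltS[ut [->|uv]]; rewrite !(updE _ _ _ u) //.
    rewrite !updt => ub uet.
    have uxt : col u != xt by apply: contraNneq xt_fresh => <-; rewrite memC.
    (* Let [u] be coloured [yt]. If some [w] of the bin coloured [yt] has class true, then [et] is
       false and [u] differs from [w], against distinctness of colours; otherwise [et] is true and
       [u] itself is such a [w]. *)
    have uyt : col u != yt.
      apply/eqP => uy; move: uet; rewrite /et; case: existsP => [[w]|none] /=.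
        case/and3P => /eqP wb /eqP wy we ue.
        have uw : u <> w by move=> uw; rewrite uw we in ue.
        have [lt|lt|//] := ltngtP u w.
          apply: (pos_fresh _ _ _ _ _ _ pos u w); rewrite ?lt ?ltn_ord //; congruence.
        apply: (pos_fresh _ _ _ _ _ _ pos w u); rewrite ?lt //; congruence.
      by move=> ue; apply: none; exists (Ordinal ut); rewrite /= ub uy ue !eqxx.
    rewrite /adj' eqxx; move: uxt uyt; rewrite /xt /yt; case: ifP => _ -> -> //.
  rewrite !updE; try by case/andP: uv.
  by rewrite adjE //; exact: (pos_clique _ _ _ _ _ _ pos).
Qed.

End Position.

(** If all loads stayed below [L], the game would reach [N] vertices with at most [2 * (L - 1)] in
    each bin, too few in total. *)
Lemma adversary_wins : (L.-1.*2 ^ 2 < m.+1)%N -> (L.-1.*2 * m.+1 < N)%N ->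
  (N ^ L <= d)%N ->
  exists s : seq 'rV[R]_d, instance m (in_tuple s) /\
    exists b k, L%:R <= seq_load a s b k.
Proof.
move=> ltm ltN Nd; apply: contrapT => none.
have small t s col bin cls adj b (k : 'I_d) :
    position t s col bin cls adj -> seq_load a s b k < L%:R.
  move=> /position_instance inst; rewrite ltNge; apply/negP => le.
  by apply: none; exists s; split=> //; exists b, k.
have reach t : (t <= N)%N -> exists s col bin cls adj, position t s col bin cls adj.
  elim: t => [_|t IH tN].
    by exists [::], (fun=> ord0), (fun=> ord0), xpredT, (fun _ _ => true);
      split => // u v; rewrite ltn0 andbF.
  have [s [col [bin [cls [adj pos]]]]] := IH (ltnW tN).
  apply: (position_extend pos L.-1.*2) => // b.
  by apply: (bin_size_le pos) => // [|k]; [exact: ltnW|exact: small pos].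
have [s [col [bin [cls [adj pos]]]]] := reach N (leqnn N).
have : (N <= \sum_(b < m.+1) L.-1.*2)%N.
  rewrite -[leqLHS](size_iota 0) -(sum_count_fibers bin); apply: leq_sum => b _.
  by apply: (bin_size_le pos) => // k; exact: small pos.
by rewrite sum_nat_const card_ord mulnC leqNgt ltN.
Qed.

End Adversary.

Lemma competitive_ge (R : realType) (A : online_algorithm R) (d L : nat) (alpha : R) :
  (0 < L)%N -> ((8 * L ^ 3) ^ L <= d)%N -> competitive A d alpha -> L%:R <= alpha.
Proof.
(* With [M = 4 * L ^ 2] machines, [(2 * (L - 1)) ^ 2 < M] and [2 * (L - 1) * M < 8 * L ^ 3]. *)
move=> L0 Ld comp; pose m := (4 * L ^ 2).-1.
have mE : m.+1 = (4 * L ^ 2)%N by rewrite /m prednK // muln_gt0 expn_gt0 L0.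
have [||s [inst [b [k le_load]]]] :=
    @adversary_wins R d m L (8 * L ^ 3) (A m d) _ _ Ld.
- by rewrite mE; case: L L0 {Ld m mE} => // l _; rewrite !expnS expn0 /= -muln2; nia.
- by rewrite mE; case: L L0 {Ld m mE} => // l _; rewrite !expnS expn0 /= -muln2; nia.
apply: le_trans le_load (le_trans _ (comp m _ _ inst k)).
rewrite -[seq_load _ _ _ _](load_run A (in_tuple s)); exact: load_le_makespan.
Qed.

(** * Asymptotics in the number of dimensions *)

Lemma ln_bounds (R : realType) (x : R) : 64 <= x -> 2 <= ln x <= x / 4.
Proof.
move=> x64; have x0 : 0 < x by lra.
have e0 : 0 < expR (1 / 2) :> R := expR_gt0 _.
have e1 : expR (1 / 2) <= 2 :> R.
  have h := expR_ge1Dx (- (1 / 2) : R).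
  have h' : expR (1 / 2) * expR (- (1 / 2)) = 1 :> R by rewrite expRxMexpNx_1.
  nra.
have e2 : expR 2 = expR (1 / 2) ^+ 4 :> R by rewrite -expRM_natl; congr expR; field.
have x8 := expR_ge1Dx (x / 8).
have x4 : expR (x / 4) = expR (x / 8) ^+ 2 by rewrite -expRM_natl; congr expR; field.
apply/andP; split; rewrite -ler_expR lnK ?posrE // ?e2 ?x4.
  apply: le_trans x64; apply: (@le_trans _ _ (2 ^+ 4)); last by lra.
  by rewrite lerXn2r ?nnegrE // ltW.
nra.
Qed.

Local Open Scope classical_set_scope.

Lemma near_ln_ge (R : realType) (c : R) : \forall d \near \oo, c <= ln d%:R.
Proof.
exists (Num.truncn (expR c)).+1 => // d /= led.
have ltd : expR c <= d%:R.
  by apply: le_trans (ltW (truncnS_gt (expR c))) _; rewrite ler_nat.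
by rewrite -ler_expR lnK // posrE (lt_le_trans (expR_gt0 c)).
Qed.

Lemma log_ratio_ge4 (R : realType) (d : nat) :
  64 <= ln d%:R :> R -> 4 <= log_ratio R d.
Proof.
move=> h; have /andP[y2 yx] := ln_bounds _ _ h.
by rewrite /log_ratio ler_pdivlMr; lra.
Qed.

(** With [L] the integer part of [z = ln d / (4 * ln (ln d))],
    [(8 * L ^ 3) ^ L <= (ln d) ^ (4 * L) <= d], since [8] and [L] are at most [ln d]. As [L >= 1],
    [z < L + 1 <= 2 * L], hence the constant [8^-1]. *)
Lemma competitive_log_ratio (R : realType) (A : online_algorithm R) (d : nat) (alpha : R) :
  64 <= ln d%:R :> R -> competitive A d alpha -> 8^-1 * log_ratio R d <= alpha.
Proof.
move=> h comp; have lr4 := log_ratio_ge4 _ _ h; have /andP[y2 yx] := ln_bounds _ _ h.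
set x := ln d%:R in h y2 yx *; set z := log_ratio R d / 4.
have z1 : 1 <= z by rewrite /z; lra.
have z0 : 0 <= z by lra.
have /andP[Lz zL] := truncn_itv z0; set L := Num.truncn z in Lz zL.
have L0 : (0 < L)%N by rewrite truncn_gt0.
have L1 : 1 <= L%:R :> R by rewrite ler1n.
have zx : z * (4 * ln x) = x by rewrite /z /log_ratio -/x; field; rewrite gt_eqF //; lra.
have d0 : 0 < d%:R :> R.
  rewrite ltr0n lt0n; apply/eqP => d0; move: h; rewrite /x d0 ln0 //; lra.
have Lx : L%:R <= x by nra.
suff /competitive_ge/(_ comp) : ((8 * L ^ 3) ^ L <= d)%N.
  by move=> /(_ L0) Lalpha; rewrite -natr1 in zL; rewrite /z in zL; lra.
rewrite -(ler_nat R) natrX natrM natrX.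
have -> : d%:R = expR x by rewrite lnK.
apply: (@le_trans _ _ (expR (4 * ln x) ^+ L)); last first.
  rewrite -expRM_natl ler_expR -[leRHS]zx ler_wpM2r //; lra.
rewrite lerXn2r ?nnegrE ?expR_ge0 //.
have -> : expR (4 * ln x) = x ^+ 4 by rewrite expRM_natl lnK // posrE; lra.
have L3 : L%:R ^+ 3 <= x ^+ 3 by rewrite lerXn2r ?nnegrE //; lra.
have x3 : 0 <= x ^+ 3 by rewrite exprn_ge0 //; lra.
rewrite [x ^+ 4]exprS; apply: ler_pM => //; lra.
Qed.

(** Here [expR (base R d) = ln d], so the threshold is six times the ratio, which is large enough to
    absorb the additive [2]. *)
Lemma threshold_le (R : realType) (d : nat) :
  64 <= ln d%:R :> R -> threshold R d + 2 <= 8 * log_ratio R d.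
Proof.
move=> h; have lr4 := log_ratio_ge4 _ _ h; have /andP[y2 yx] := ln_bounds _ _ h.
have -> : threshold R d = 6 * log_ratio R d; last by lra.
rewrite /threshold /log_ratio /base max_r // lnK; last by rewrite posrE; lra.
by field; rewrite gt_eqF //; lra.
Qed.

Theorem theorem1 (R : realType) :
  ((forall (A : online_algorithm R) (alpha : nat -> R),
      (\forall d \near \oo, competitive A d (alpha d)) ->
      alpha =Omega_\oo (@log_ratio R)) /\
   ~ (exists (A : online_algorithm R) (alpha : nat -> R),
      (\forall d \near \oo, competitive A d (alpha d)) /\
      alpha =o_\oo (@log_ratio R))) /\
  (exists (A : online_algorithm R) (alpha : nat -> R),
      (forall d : nat, (1 <= d)%N -> competitive A d (alpha d)) /\
      alpha =O_\oo (@log_ratio R)).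
Proof.
have lower (A : online_algorithm R) (alpha : nat -> R) :
    (\forall d \near \oo, competitive A d (alpha d)) ->
    \forall d \near \oo, 8^-1 * `|log_ratio R d| <= `|alpha d|.
  move=> comp; near=> d.
  have h : 64 <= ln d%:R :> R by near: d; exact: near_ln_ge.
  have lr4 := log_ratio_ge4 _ _ h; rewrite ger0_norm; last by lra.
  apply: le_trans (ler_norm _); apply: (competitive_log_ratio _ A) => //.
  by near: d.
split; [split|].
- move=> A alpha /lower h; rewrite eqOmegaE qualifE.
  by apply/asboolP; exists 8^-1.
(* Any positive constant below [8^-1] contradicts the lower bound, the ratio being positive for
   large [d]. *)
- move=> [A [alpha [/lower h /eqoP/(_ 16^-1)]]].
  rewrite invr_gt0 ltr0n => /(_ isT) small.
  have : \forall d \near \oo, False.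
    near=> d.
    have h64 : 64 <= ln d%:R :> R by near: d; exact: near_ln_ge.
    have h1 : 8^-1 * `|log_ratio R d| <= `|alpha d| by near: d.
    have h2 : `|alpha d| <= 16^-1 * `|log_ratio R d| by near: d.
    have lr4 := log_ratio_ge4 _ _ h64; have lrn := ler_norm (log_ratio R d); lra.
  by move=> /filter_ex[].
- exists (vector_scheduler R), (fun d => threshold R d + 2); split.
    exact: vector_scheduler_competitive.
  apply/eqO_exP; exists 8 => //; near=> d.
  have h : 64 <= ln d%:R :> R by near: d; exact: near_ln_ge.
  have lr4 := log_ratio_ge4 _ _ h.
  have T0 := threshold_ge0 R d.
  by rewrite !ger0_norm ?threshold_le //; lra.
Unshelve. all: by end_near. Qed.
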